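(* For every real $\varepsilon > 0$ and every integer $k \geq 2$ there exists $\Delta_0 = \Delta_0(\varepsilon, k)$ such that the following holds for every integer $\Delta \geq \Delta_0$. Let $H$ be a $k$-uniform $k$-partite hypergraph of maximum degree at most $\Delta$. Then $$\mathrm{ch}(H) \leq \left(\frac{4}{5}\,(k-1+\varepsilon)\,\frac{\Delta}{\log \Delta}\right)^{1/(k-1)}.$$
   Context: All hypergraphs are finite and undirected. $\log$ is the natural logarithm. A $k$-uniform hypergraph is a pair $H = (V,E)$ where $V$ is a set of vertices and $E$ is a collection of $k$-element subsets of $V$, called edges. The degree of a vertex $v$ is the number of edges containing $v$, and the maximum degree of $H$ is the largest degree of a vertex. $H$ is $k$-partite if there is a partition $V = V_1 \sqcup \cdots \sqcup V_k$ such that every edge contains precisely one vertex from each $V_i$. A set $J \subseteq V$ is independent if no edge $e \in E$ satisfies $e \subseteq J$. A proper coloring of $H$ is an assignment of nonnegative integers (colors) to the vertices such that every color class is an independent set (equivalently, no edge is monochromatic). A list assignment is a function $L$ assigning to each vertex $v$ a set $L(v)$ of nonnegative integers; a proper $L$-coloring is a proper coloring in which each vertex $v$ receives a color from $L(v)$. For $q \in \mathbb{N}$, $H$ is $q$-choosable if $H$ admits a proper $L$-coloring for every list assignment $L$ with $|L(v)| \geq q$ for every vertex $v$. The choice number $\mathrm{ch}(H)$ is the minimum $q$ such that $H$ is $q$-choosable. *)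

(* Defs.v *)
From mathcomp Require Import all_boot all_order all_algebra.
From mathcomp Require Import all_classical all_reals all_analysis.

Set Implicit Arguments.
Unset Strict Implicit.
Unset Printing Implicit Defensive.

Record hypergraph := Hypergraph {
  vertex :> finType;
  edges : {set {set vertex}} }.

Definition uniform (k : nat) (H : hypergraph) : Prop :=
  forall e, e \in edges H -> #|e| = k.

(* The parts [P i] are allowed to be empty. *)
Definition partite (k : nat) (H : hypergraph) : Prop :=
  exists P : 'I_k -> {set H},
    (forall v : H, exists! i, v \in P i) /\
    (forall e, e \in edges H -> forall i, #|e :&: P i| = 1).

Definition degree (H : hypergraph) (v : H) : nat :=
  #|[set e in edges H | v \in e]|.

Definition max_degree (H : hypergraph) : nat := \max_(v : H) degree v.

Definition independent (H : hypergraph) (J : {set H}) : Prop :=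
  forall e, e \in edges H -> ~~ (e \subset J).

Definition proper_coloring (H : hypergraph) (f : H -> nat) : Prop :=
  forall c : nat, independent [set v : H | f v == c].

Definition proper_list_coloring (H : hypergraph) (L : H -> set nat)
    (f : H -> nat) : Prop :=
  proper_coloring f /\ forall v, L v (f v).

(* Lists may be infinite, so [q <= |L v|] is expressed by an injection from
   [{0, ..., q - 1}] into [L v]. *)
Definition choosable (H : hypergraph) (q : nat) : Prop :=
  forall L : H -> set nat,
    (forall v, (`I_q #<= L v)%card) ->
    exists f : H -> nat, proper_list_coloring L f.

Definition is_choice_number (H : hypergraph) (q : nat) : Prop :=
  choosable H q /\ forall q', choosable H q' -> q <= q'.

(* The default value 0 is returned when [H] is not choosable for any [q]; this
   requires an edge with at most one vertex, see [choice_numberP]. *)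
Definition choice_number (H : hypergraph) : nat :=
  xget 0 (is_choice_number H : set nat).

Lemma card_le_fresh (A : set nat) (q : nat) (s : seq nat) :
  (`I_q #<= A)%card -> size s < q -> exists2 c, A c & c \notin s.
Proof.
move=> /pcard_leP[f] sq.
have fA i : i < q -> A (f i) by move=> iq; exact: (@funS _ _ _ _ f).
have [/allP sub|] := boolP (all [in s] [seq f i | i <- iota 0 q]).
  suff /uniq_leq_size/(_ sub) : uniq [seq f i | i <- iota 0 q].
    by rewrite size_map size_iota leqNgt sq.
  rewrite map_inj_in_uniq ?iota_uniq// => i j.
  by rewrite !mem_iota !add0n /= => iq jq; apply: (@inj _ _ _ f); exact: mem_set.
move=> /allPn[_ /mapP[i + ->] fi]; rewrite mem_iota add0n => /= iq.
by exists (f i) => //; exact: fA.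
Qed.

Lemma choosable_card (H : hypergraph) :
  (forall e, e \in edges H -> 1 < #|e|) -> choosable H #|H|.
Proof.
move=> e_gt1 L Lq.
have [f [fL finj]] : exists f : H -> nat,
    {in enum H, forall v, L v (f v)} /\ {in enum H &, injective f}.
  have : size (enum H) <= #|H| by rewrite -cardE.
  elim: (enum H) (enum_uniq H) => [|v s IH] /=; first by exists (fun=> 0).
  move=> /andP[vs us] sq; have [f [fL finj]] := IH us (ltnW sq).
  have [c Lc cs] : exists2 c, L v c & c \notin map f s.
    by apply: card_le_fresh (Lq v) _; rewrite size_map.
  exists (fun u => if u == v then c else f u); split=> [u|u w]; rewrite !inE.
    by case: eqVneq => [->//|_] /= us'; exact: fL.
  case: (eqVneq u v) => [->|_]; case: (eqVneq w v) => [->|_] //=.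
  - by move=> _ ws cE; move: cs; rewrite cE map_f.
  - by move=> us' _ cE; move: cs; rewrite -cE map_f.
  - exact: finj.
exists f; split=> [c e eE|v]; last by apply: fL; rewrite mem_enum.
apply/negP => /fintype.subsetP esub.
have /card_gt1P[x [y [xe ye /negP[]]]] := e_gt1 _ eE.
apply/eqP/finj; rewrite ?mem_enum//.
by move: (esub _ xe) (esub _ ye); rewrite !inE => /eqP-> /eqP->.
Qed.

Lemma choice_numberP (H : hypergraph) :
  (forall e, e \in edges H -> 1 < #|e|) ->
  is_choice_number H (choice_number H).
Proof.
move=> /choosable_card Hc; rewrite /choice_number.
have ex : exists q, `[< choosable H q >] by exists #|H|; apply/asboolP.
case: (ex_minnP ex) => q /asboolP qc qmin.
apply: (xgetPex 0 (P := (is_choice_number H : set nat))).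
by exists q; split=> // q' /asboolP; exact: qmin.
Qed.

(* Main.v *)
(* Let [n = k - 1]. Only two parts [A] and [B] of the partition matter. Colour
   the vertices outside [B] independently at random from their lists and give
   each [b] in [B] a colour [c] of its list such that no edge at [b] has all its
   other vertices coloured [c]. If each list has [q] colours, and all colours
   are picked uniformly, then the expected number of such [c] is about
   [q * exp (- Delta / q ^ n)], at least a positive power of [Delta] when
   [q ^ n >= (n + eps) * Delta / ln Delta]; the local lemma concludes.
   To gain the factor 4/5, use the order of the colours: the vertices of [A]
   favour small colours, with weights close to [x^(-1/2) / 2] on the rescaled
   rank [x], while the colours of [b] are weighted in the reverse way. The
   expected load of a colour of [b] is then governed by an alignment of two
   sorted lists, and since the self-convolution of [x^(-1/2) / 2] is constant,
   equal to pi/4, on ]0, 1], no alignment does better than pi/4 < 4/5. We use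
   the discrete analogue ['C(2j, j) / 4 ^ j] on 16 blocks of equal length, which
   keeps the weights bounded and already beats 4/5. *)
Require Import Defs.
From mathcomp Require Import all_boot all_order all_algebra.
From mathcomp Require Import all_classical all_reals all_analysis.
From mathcomp Require Import ring lra.
Set Implicit Arguments.
Unset Strict Implicit.
Unset Printing Implicit Defensive.
Import Order.TTheory GRing.Theory Num.Theory.
Local Open Scope ring_scope.

(** * Alignments of two sorted lists and self-convolutions *)

Section Convolution.
Context {R : realFieldType}.
Implicit Type P : nat -> R.

Definition selfconv P n : R := \sum_(k < n) P k * P (n.-1 - k)%N.

(* The potential of the alignment argument in [overlap_le]: a match of ranks [i]
   and [z - 1] moves the state from [(i, z)] to [(i + 1, z - 1)] and lowers it by
   exactly [P i * P (z - 1)]; skipping a colour of either list does not raise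
   it. *)
Definition tail_conv P i z : R := \sum_(k < z) P (i + k)%N * P (z.-1 - k)%N.

Lemma tail_conv_step P i z :
  tail_conv P i z.+1 = P i * P z + tail_conv P i.+1 z.
Proof.
rewrite /tail_conv big_ord_recl addn0 subn0/=; congr (_ + _).
by apply: eq_bigr => -[k kz] _ /=; rewrite addnS addSn subnS predn_sub.
Qed.

Lemma tail_conv_le P i z : (forall n, 0 <= P n) ->
  {homo P : m n / (m <= n)%N >-> n <= m} ->
  tail_conv P i.+1 z <= tail_conv P i z.
Proof.
move=> P0 Pd; apply: ler_sum => k _; apply: ler_wpM2r => //.
by apply: Pd; rewrite addSn.
Qed.

Lemma selfconv_split P i z :
  selfconv P (i + z) =
  \sum_(k < i) P k * P ((i + z).-1 - k)%N + tail_conv P i z.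
Proof.
rewrite /selfconv big_split_ord/=; congr (_ + _).
apply: eq_bigr => -[k kz] _ /=; congr (_ * P _).
by case: z kz => // z kz; rewrite addnS/= subnDl.
Qed.

(** In [selfconv_split], the head sum can only fall as [z] grows, because [P] is nonincreasing,
    while the whole self-convolution does not fall; so the tail does not fall either. *)
Lemma tail_conv_leS P i z : (forall n, 0 <= P n) ->
  {homo P : m n / (m <= n)%N >-> n <= m} ->
  {homo selfconv P : m n / (m <= n)%N >-> m <= n} ->
  tail_conv P i z <= tail_conv P i z.+1.
Proof.
move=> P0 Pd Pc; have := Pc (i + z)%N (i + z.+1)%N.
rewrite leq_add2l leqnSn !selfconv_split => /(_ isT).
have : \sum_(k < i) P k * P ((i + z.+1).-1 - k)%N <=
       \sum_(k < i) P k * P ((i + z).-1 - k)%N.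
  apply: ler_sum => -[k ki] _ /=; apply: ler_wpM2l => //.
  by apply: Pd; rewrite leq_sub2r// addnS/= leq_pred.
lra.
Qed.

(* [overlap P s i t] is the total of [P (rank of c in s, shifted by i)] times
   [P (rank of c in t, counted from the top)] over the common entries [c]. *)
Fixpoint overlap P (s : seq nat) (i : nat) (t : seq nat) : R :=
  if s is x :: s' then
    (if x \in t then P i * P ((size t).-1 - index x t)%N else 0)
    + overlap P s' i.+1 t
  else 0.

Lemma overlap_drop P s i y t : y \notin s ->
  overlap P s i (y :: t) = overlap P s i t.
Proof.
elim: s i => //= x s IH i; rewrite inE negb_or => /andP[yx ys].
rewrite IH// inE eq_sym (negPf yx)/=; congr (_ + _); case: ifP => // xt.
by congr (_ * P _); case: t xt {IH} => //= z t _; rewrite subSS.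
Qed.

(** Induction by merging: the smaller of the two heads is absent from the other list and is dropped,
    equal heads are matched. Ranks in [t] are counted from the top, so dropping the head of [t]
    leaves the remaining ranks unchanged. *)
Lemma overlap_le P s i t : (forall n, 0 <= P n) ->
  {homo P : m n / (m <= n)%N >-> n <= m} ->
  {homo selfconv P : m n / (m <= n)%N >-> m <= n} ->
  sorted ltn s -> sorted ltn t ->
  overlap P s i t <= tail_conv P i (size t).
Proof.
move=> P0 Pd Pc.
have [n] := ubnP (size s + size t)%N.
elim: n s i t => // n IH [|x s] i t.
  by move=> _ _ _; apply: sumr_ge0 => k _; rewrite mulr_ge0.
case: t => [|y t] st ss tt.
  rewrite /= add0r; apply: le_trans (IH s i.+1 [::] _ _ _) _ => //.
    exact: path_sorted ss.
  by rewrite /tail_conv !big_ord0.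
have notin a b u : (a < b)%N -> path ltn b u -> a \notin u.
  move=> ab /(order_path_min ltn_trans)/allP h; apply/negP => /h.
  by rewrite ltnNge (ltnW ab).
have [xy|yx|xy] := ltngtP x y.
- have xt : x \notin y :: t.
    by rewrite inE negb_or neq_ltn xy /=; apply: notin xy tt.
  rewrite /= (negPf xt) add0r.
  apply: le_trans (IH s i.+1 (y :: t) _ _ _) _ => //.
    exact: path_sorted ss.
  exact: tail_conv_le.
- have ys : y \notin x :: s.
    by rewrite inE negb_or neq_ltn yx /=; apply: notin yx ss.
  rewrite overlap_drop//; apply: le_trans (IH _ _ t _ _ _) _ => //.
    by move: st; rewrite /= addnS.
  - exact: path_sorted tt.
  - exact: tail_conv_leS.
rewrite -{}xy in tt *.
have ns : x \notin s.
  have /allP h := order_path_min ltn_trans ss; apply/negP => /h.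
  by rewrite ltnn.
rewrite /= inE eqxx/= subn0 overlap_drop// tail_conv_step lerD2l.
apply: IH; [|exact: path_sorted ss|exact: path_sorted tt].
by move: st; rewrite /= addnS addSn => /ltnW.
Qed.

Lemma overlapE P s i t : uniq t ->
  overlap P s i t = \sum_(j < size t) \sum_(l < size s)
    (nth 0%N s l == nth 0%N t j)%:R * (P (i + l)%N * P ((size t).-1 - j)%N).
Proof.
move=> ut; elim: s i => [|x s IH] i /=.
  by rewrite big1// => j _; rewrite big_ord0.
rewrite IH; under [RHS]eq_bigr do rewrite big_ord_recl/= addn0.
rewrite big_split/=; congr (_ + _); last first.
  by apply: eq_bigr => j _; apply: eq_bigr => l _; rewrite addnS addSn.
case: ifPn => xt; last first.
  rewrite big1// => -[j jt] _; case: eqP => [xE|_]; last by rewrite mul0r.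
  by move: xt; rewrite xE mem_nth.
have it : (index x t < size t)%N by rewrite index_mem.
rewrite (bigD1 (Ordinal it))//= nth_index// eqxx mul1r big1 ?addr0//.
move=> -[j jt] /= jE; case: eqP => [xE|_]; last by rewrite mul0r.
by case/negP: jE; rewrite -val_eqE/= xE index_uniq.
Qed.

Lemma sum_overlap_le P s t : (forall n, 0 <= P n) ->
  {homo P : m n / (m <= n)%N >-> n <= m} ->
  {homo selfconv P : m n / (m <= n)%N >-> m <= n} ->
  sorted ltn s -> sorted ltn t ->
  \sum_(j < size t) \sum_(l < size s)
    (nth 0%N s l == nth 0%N t j)%:R * (P l * P ((size t).-1 - j)%N)
  <= selfconv P (size t).
Proof.
move=> P0 Pd Pc ss st.
have := overlap_le 0 P0 Pd Pc ss st.
by rewrite overlapE//; exact: sorted_uniq ltn_trans ltnn _ st.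
Qed.

End Convolution.

(** * Central binomial weights *)

Section CentralBinomialWeights.
Context {R : realFieldType}.

(* The coefficients of [(1 - x)^(-1/2)], i.e. ['C(2n, n) / 4 ^ n]. *)
Fixpoint cbw (n : nat) : R :=
  if n is n'.+1 then cbw n' * ((2 * n'%:R + 1) / (2 * n'%:R + 2)) else 1.

Lemma cbw_gt0 n : 0 < cbw n.
Proof.
elim: n => [|n IH] /=; first exact: ltr01.
have := ler0n R n; move=> ?; apply: mulr_gt0 => //; apply: divr_gt0; lra.
Qed.

Lemma cbw_le : {homo cbw : m n / (m <= n)%N >-> n <= m}.
Proof.
apply: homo_leq => [//|x y z yx zy|n]; first exact: le_trans zy yx.
have := cbw_gt0 n; have := ler0n R n => /= n0 c0.
rewrite ger_pMr// ler_pdivrMr; lra.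
Qed.

Lemma cbw_recr n : n.+1%:R * cbw n.+1 = (n%:R + 1 / 2) * cbw n.
Proof.
have n0 := ler0n R n; rewrite /= -natr1; field; lra.
Qed.

(* Weight the sum [a_n = \sum_k p_k p_(n - k)] by [k]: by symmetry this
   multiplies it by [n / 2], and the recurrence turns the weighted [a_(n + 1)]
   into [(n + 1) / 2 * a_n]. *)
Lemma selfconv_cbw n : selfconv cbw n.+1 = 1.
Proof.
pose a n := selfconv cbw n.+1; rewrite -/(a n).
have half m : 2 * (\sum_(k < m.+1) k%:R * (cbw k * cbw (m - k)%N)) = m%:R * a m.
  rewrite mulr2n mulrDl !mul1r [X in X + _](reindex_inj rev_ord_inj)/=.
  rewrite -big_split/= mulr_sumr; apply: eq_bigr => -[k /= km] _.
  rewrite ltnS in km; rewrite !subSS subKn// natrB//=; ring.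
elim: n => [|n IH].
  by rewrite /a /selfconv big_ord_recl big_ord0 addr0 /= mulr1.
rewrite -[RHS]IH.
have n0 : (n.+1%:R : R) != 0 by rewrite pnatr_eq0.
apply: (mulfI n0); rewrite -half big_ord_recl/= mul0r add0r.
under eq_bigr => k _ do
  rewrite mulrA /bump/= add1n subSS cbw_recr mulrDl mulrDl -!mulrA.
rewrite big_split/= -mulr_sumr mulrDr half -mulr_sumr.
rewrite (_ : \sum_(k < n.+1) cbw k * cbw (n - k)%N = a n); last by apply: eq_bigr.
rewrite -natr1; by field.
Qed.

Lemma sum_cbw n : \sum_(k < n) cbw k = 2 * n%:R * cbw n.
Proof.
elim: n => [|n IH]; first by rewrite big_ord0 mulr0 mul0r.
rewrite big_ord_recr/= IH -mulrA -mulrA -/(cbw n.+1) cbw_recr; by field.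
Qed.

(** The source of the constant 4/5: by [sum_cbw] the first 16 weights add up to [S = 32 * cbw 16],
    and the inequality is equivalent to [16 / S ^ 2 <= 4 / 5]. *)
Lemma cbw16 : 5 / 4 <= 4 * 16 * cbw 16 ^+ 2 :> R.
Proof.
have e4 : cbw 4 = 35 / 128 by rewrite /=; field.
have e8 : cbw 8 = cbw 4 * (9 / 10 * 11 / 12 * 13 / 14 * 15 / 16).
  by rewrite /=; field.
have e12 : cbw 12 = cbw 8 * (17 / 18 * 19 / 20 * 21 / 22 * 23 / 24).
  by rewrite /=; field.
have e16 : cbw 16 = cbw 12 * (25 / 26 * 27 / 28 * 29 / 30 * 31 / 32).
  by rewrite /=; field.
have : 1399 / 10000 <= cbw 16 by rewrite e16 e12 e8 e4; lra.
by move=> h; rewrite expr2; nra.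
Qed.

End CentralBinomialWeights.

(** * Weights constant on blocks of ranks *)

Section BlockWeights.
Context {R : realFieldType}.

(** Meant for block weights: there the increments [P k.+1 - P k] vanish unless the block length
    divides [k.+1], which reduces the sum to one over blocks. *)
Lemma selfconv_diff (P : nat -> R) n :
  selfconv P n.+1 - selfconv P n =
  P n * P 0%N + \sum_(k < n) P (n - k.+1)%N * (P k.+1 - P k).
Proof.
rewrite /selfconv (reindex_inj rev_ord_inj)/= big_ord_recl/= subn1/=.
rewrite subnn -addrA; congr (_ + _).
rewrite [X in _ - X](reindex_inj rev_ord_inj)/= -sumrB; apply: eq_bigr => -[k kn] _.
case: n kn => // n kn; rewrite /bump add1n /= !subSS mulrBr.
by rewrite !subKn // subSn ?leq_subr // subKn.
Qed.

Lemma sum_multiples m n (G : nat -> R) : (0 < m)%N ->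
  \sum_(k < n) (m %| k.+1)%:R * G k.+1 = \sum_(j < n %/ m) G (j.+1 * m)%N.
Proof.
move=> m0; elim: n => [|n IH]; first by rewrite div0n !big_ord0.
rewrite big_ord_recr/= IH; have := divnS n m0.
case: (boolP (m %| n.+1)%N) => mn ->; last by rewrite mul0r addr0.
rewrite add1n big_ord_recr/= mul1r; congr (_ + G _).
by move: (divnS n m0); rewrite mn add1n => <-; rewrite divnK.
Qed.

Definition blockw m i : R := cbw (i %/ m).

Lemma blockw_ge0 m i : 0 <= blockw m i.
Proof. exact/ltW/cbw_gt0. Qed.

Lemma blockw_le m : {homo blockw m : i j / (i <= j)%N >-> j <= i}.
Proof. by move=> i j ij; apply: cbw_le; exact: leq_div2r. Qed.

Lemma blockw_le1 m i : blockw m i <= 1.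
Proof. exact: (@cbw_le _ 0 _ (leq0n _)). Qed.

Lemma sum_blockw m n : (0 < m)%N ->
  \sum_(i < n * m) blockw m i = m%:R * \sum_(j < n) cbw j.
Proof.
move=> m0; elim: n => [|n IH]; first by rewrite mul0n !big_ord0 mulr0.
rewrite mulSn addnC big_split_ord/= IH big_ord_recr/= mulrDr; congr (_ + _).
rewrite (eq_bigr (fun=> cbw n)) ?sumr_const ?card_ord ?mulr_natl//.
by move=> i _; rewrite /blockw divnMDl// divn_small ?addn0.
Qed.

(** The increment at [n] equals that of [selfconv cbw] at [n %/ m], which by [selfconv_cbw] is 1 at
    0 and 0 afterwards. *)
Lemma selfconv_blockw m n : (0 < m)%N ->
  selfconv (blockw m) n = (minn n m)%:R.
Proof.
move=> m0; elim: n => [|n IH]; first by rewrite min0n /selfconv big_ord0.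
have -> : (minn n.+1 m = minn n m + (n < m))%N.
  by case: ltnP => nm; [rewrite !(minn_idPl _) ?addn1// ltnW
                       |rewrite !(minn_idPr _) ?addn0// leqW].
rewrite natrD -IH -[LHS](subrK (selfconv (blockw m) n)) addrC; congr (_ + _).
rewrite selfconv_diff {IH}.
transitivity (cbw (n %/ m) * cbw 0 + \sum_(j < n %/ m)
    cbw (n %/ m - j.+1)%N * (cbw j.+1 - cbw j) : R); last first.
  rewrite -selfconv_diff selfconv_cbw.
  have [nm|mn] := ltnP n m.
    by rewrite divn_small// /selfconv big_ord0 subr0.
  have : (0 < n %/ m)%N by rewrite divn_gt0.
  by case: (n %/ m)%N => // a _; rewrite selfconv_cbw subrr.
congr (_ + _); first by rewrite /blockw div0n.
pose G k : R := cbw ((n - k) %/ m) * (cbw (k %/ m) - cbw (k %/ m).-1).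
transitivity (\sum_(k < n) (m %| k.+1)%:R * G k.+1).
  apply: eq_bigr => -[k kn] _ /=; rewrite /blockw /G divnS//.
  by case: (m %| k.+1)%N; rewrite /= ?mul1r// subrr mulr0 mul0r.
rewrite sum_multiples//; apply: eq_bigr => j _.
rewrite /G mulnK//=; congr (cbw _ * _).
by rewrite divnBMl.
Qed.

Lemma blockw_overlap m s t : (0 < m)%N -> sorted ltn s -> sorted ltn t ->
  \sum_(j < size t) \sum_(l < size s)
    (nth 0%N s l == nth 0%N t j)%:R *
    (blockw m l * blockw m ((size t).-1 - j)%N) <= m%:R.
Proof.
move=> m0 ss st; apply: le_trans (sum_overlap_le _ _ _ ss st) _.
- exact: blockw_ge0.
- exact: blockw_le.
- move=> i j ij; rewrite !selfconv_blockw// ler_nat.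
  by rewrite leq_min geq_minr andbT (leq_trans (geq_minl _ _)).
by rewrite selfconv_blockw// ler_nat geq_minr.
Qed.

End BlockWeights.

(** * Expectation over independent random choices *)

Section ProductExpectation.
Context {R : realFieldType} {V T : finType}.
Variable w : V -> T -> R.
Hypothesis w_ge0 : forall v t, 0 <= w v t.
Hypothesis w_sum1 : forall v, \sum_t w v t = 1.
Implicit Types (f g : {ffun V -> T}) (F G : {ffun V -> T} -> R).

Definition weight f : R := \prod_v w v (f v).

Definition expect F : R := \sum_f weight f * F f.

Definition depends_on {U : Type} (S : {set V}) (F : {ffun V -> T} -> U) :=
  forall f g, {in S, f =1 g} -> F f = F g.

Lemma weight_ge0 f : 0 <= weight f.
Proof. exact: prodr_ge0. Qed.

Lemma expect_le F G : (forall f, F f <= G f) -> expect F <= expect G.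
Proof. by move=> FG; apply: ler_sum => f _; rewrite ler_wpM2l ?weight_ge0. Qed.

Lemma expect_eq F G : (forall f, F f = G f) -> expect F = expect G.
Proof. by move=> FG; apply: eq_bigr => f _; rewrite FG. Qed.

Lemma expect_ge0 F : (forall f, 0 <= F f) -> 0 <= expect F.
Proof. by move=> F0; apply: sumr_ge0 => f _; rewrite mulr_ge0 ?weight_ge0. Qed.

Lemma expectD F G : expect (fun f => F f + G f) = expect F + expect G.
Proof. by rewrite /expect -big_split; apply: eq_bigr => f _; rewrite mulrDr. Qed.

Lemma expect_sum (I : finType) (P : pred I) (F : I -> {ffun V -> T} -> R) :
  expect (fun f => \sum_(i | P i) F i f) = \sum_(i | P i) expect (F i).
Proof.
by rewrite /expect exchange_big; apply: eq_bigr => f _; rewrite mulr_sumr.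
Qed.

Lemma expectZ c F : expect (fun f => c * F f) = c * expect F.
Proof. by rewrite /expect mulr_sumr; apply: eq_bigr => f _; rewrite mulrCA. Qed.

Lemma expect_cst c : expect (fun=> c) = c.
Proof.
rewrite /expect -mulr_suml -(bigA_distr_bigA (fun v t => w v t))/=.
by rewrite big1 ?mul1r.
Qed.

Lemma expect_row v (h : T -> R) :
  expect (fun f => h (f v)) = \sum_t w v t * h t.
Proof.
pose F (u : V) (t : T) : R := w u t * (if u == v then h t else 1).
transitivity (\sum_(f : {ffun V -> T}) \prod_u F u (f u)).
  apply: eq_bigr => f _; rewrite /weight /F big_split/=; congr (_ * _).
  by rewrite -big_mkcond/= big_pred1_eq.
rewrite -(bigA_distr_bigA F) (bigD1 v)//= [X in _ * X]big1 ?mulr1.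
  by apply: eq_bigr => t _; rewrite /F eqxx.
move=> u uv; rewrite -(w_sum1 u); apply: eq_bigr => t _.
by rewrite /F (negPf uv) mulr1.
Qed.

(* Two independent samples may exchange their restrictions to [~: S]. *)
Lemma expectM (S : {set V}) F G : depends_on S F -> depends_on (~: S) G ->
  expect (fun f => F f * G f) = expect F * expect G.
Proof.
move=> FS GS.
pose mix f g : {ffun V -> T} := [ffun v => if v \in S then f v else g v].
have mixE f g : weight (mix f g) * weight (mix g f) = weight f * weight g.
  rewrite /weight -!big_split; apply: eq_bigr => v _; rewrite /= !ffunE.
  by case: ifP => // _; rewrite mulrC.
have Fmix f g : F (mix f g) = F f by apply: FS => v vS; rewrite ffunE vS.
have Gmix f g : G (mix f g) = G g.
  by apply: GS => v; rewrite inE => /negPf vS; rewrite ffunE vS.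
rewrite -[LHS]mulr1 -(expect_cst 1) /expect [LHS]mulr_suml [RHS]mulr_suml.
under eq_bigr do rewrite mulr_sumr.
under [RHS]eq_bigr do rewrite mulr_sumr.
rewrite !pair_bigA/=.
rewrite [RHS](reindex_inj (h := fun p => (mix p.1 p.2, mix p.2 p.1)))/=.
  apply: eq_bigr => -[f g] _ /=; rewrite Fmix Gmix.
  have := mixE f g; set a := weight _; set b := weight (mix g f) => ab.
  have -> : a * F f * (b * G f) = (a * b) * (F f * G f) by ring.
  by rewrite ab; ring.
apply: (can_inj (g := fun p => (mix p.1 p.2, mix p.2 p.1))) => -[f g].
by congr (_, _); apply/ffunP => v; rewrite /= !ffunE; case: (v \in S).
Qed.

End ProductExpectation.

(** * The symmetric local lemma *)

Section LocalLemma.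
Context {R : realFieldType} {V T : finType}.
Variable w : V -> T -> R.
Hypothesis w_ge0 : forall v t, 0 <= w v t.
Hypothesis w_sum1 : forall v, \sum_t w v t = 1.
Context {I : finType} (bad : I -> pred {ffun V -> T}) (S : I -> {set V}).
Variables (p : R) (d : nat).
Hypothesis bad_dep : forall i, depends_on (S i) (bad i).
Hypothesis bad_le : forall i, expect w (fun f => (bad i f)%:R) <= p.
Hypothesis dep_le : forall i, (#|[set j | ~~ [disjoint S i & S j]]| <= d)%N.
Hypothesis pd_le : 4 * p * d%:R <= 1.
Hypothesis d_gt0 : (0 < d)%N.

Let none (X : {set I}) f := [forall j in X, ~~ bad j f].
Let Pr (A : pred {ffun V -> T}) := expect w (fun f => (A f)%:R).

Let Pr_le (A B : pred {ffun V -> T}) : (forall f, A f -> B f) -> Pr A <= Pr B.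
Proof.
move=> AB; apply: expect_le => // f; rewrite ler_nat.
by case: (boolP (A f)) => // /AB ->.
Qed.

Let Pr_ge0 A : 0 <= Pr A.
Proof. by apply: expect_ge0 => // f; exact: ler0n. Qed.

Let none_sub (X Y : {set I}) f : X \subset Y -> none Y f -> none X f.
Proof.
move=> /fintype.subsetP XY /forall_inP h; apply/forall_inP => j jX.
exact: h (XY _ jX).
Qed.

Let p_ge0 (i : I) : 0 <= p.
Proof. exact: le_trans (Pr_ge0 (bad i)) (bad_le i). Qed.

(** The conditional probability bound [2 * p], stated without division. Induction on the size of
    [X]: the events of [X2] are jointly independent of [bad i], those of [X1] may share variables
    with it. *)
Let cond_le i (X : {set I}) :
  Pr (fun f => bad i f && none X f) <= 2 * p * Pr (none X).
Proof.
have [n] := ubnP #|X|; elim: n i X => // n IH i X Xn.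
have p0 := p_ge0 i.
pose D := [set j | ~~ [disjoint S i & S j]].
pose X1 := X :&: D; pose X2 := X :\: D.
have X2X : X2 \subset X by exact: subsetDl.
have step1 : Pr (fun f => bad i f && none X f) <= p * Pr (none X2).
  apply: (@le_trans _ _ (Pr (fun f => bad i f && none X2 f))).
    by apply: Pr_le => f /andP[-> /(none_sub X2X)].
  rewrite /Pr; under [X in X <= _]expect_eq do rewrite -mulnb natrM.
  rewrite (expectM w_sum1 (S := S i)).
  - by apply: ler_wpM2r => //; exact: Pr_ge0.
  - by move=> f g fg; rewrite (bad_dep fg).
  - move=> f g fg; congr (nat_of_bool _)%:R.
    apply: eq_forallb_in => j; rewrite /X2 finset.in_setD inE negbK => /andP[ij _].
    congr (~~ _); apply: bad_dep => v vj; apply: fg; rewrite inE.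
    by rewrite (disjointFl ij).
have [X10|X1n0] := eqVneq X1 finset.set0.
  have X2E : X2 = X.
    by rewrite -[RHS](finset.setID X D) -/X1 X10 finset.set0U.
  apply: le_trans step1 _; rewrite X2E ler_wpM2r ?Pr_ge0//; lra.
have X2n : (#|X2| < n)%N.
  rewrite -ltnS; apply: leq_trans Xn; rewrite ltnS -(cardsID D X).
  by rewrite -/X1 -/X2 -[ltnLHS]add0n ltn_add2r card_gt0.
(* Union bound over [X1]. By induction its at most [d] events cost a fraction at most
   [2 * p * d <= 1 / 2], so [none X] keeps at least half the probability of [none X2]. *)
have : Pr (none X2) - \sum_(j in X1) Pr (fun f => bad j f && none X2 f)
    <= Pr (none X).
  rewrite lerBlDr /Pr -expect_sum -expectD; apply: expect_le => // f.
  case: (boolP (none X2 f)) => [nX2|_]; last first.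
    by rewrite addr_ge0//; apply: sumr_ge0 => j _; exact: ler0n.
  case: (boolP (none X f)) => [_|].
    by rewrite lerDl; apply: sumr_ge0 => j _; exact: ler0n.
  case/forall_inPn => j jX; rewrite negbK => bj; rewrite add0r.
  have jX1 : j \in X1.
    rewrite /X1 finset.in_setI jX /=; apply: contraLR bj => jD.
    move/forall_inP: nX2; apply.
    by rewrite /X2 finset.in_setD jX jD.
  rewrite (bigD1 j)//= bj lerDl; apply: sumr_ge0 => ? _; exact: ler0n.
have : \sum_(j in X1) Pr (fun f => bad j f && none X2 f) <=
       d%:R * (2 * p * Pr (none X2)).
  apply: (@le_trans _ _ (\sum_(j in X1) (2 * p * Pr (none X2)))).
    by apply: ler_sum => j _; exact: IH.
  rewrite sumr_const -[leLHS]mulr_natl; apply: ler_wpM2r.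
    by rewrite !mulr_ge0 ?Pr_ge0.
  rewrite ler_nat; apply: leq_trans (dep_le i).
  by apply: subset_leq_card; exact: subsetIr.
have := Pr_ge0 (none X2); move: step1 p0 pd_le.
set a := Pr (none X2); set b := \sum_(_ in _) _; set c := Pr (none X).
move=> step1 p0 pd a0 bd ac.
apply: le_trans step1 _; rewrite mulrAC [in leRHS]mulrC ler_wpM2l//.
have : a * (4 * p * d%:R) <= a * 1 by rewrite ler_wpM2l.
have dE : d%:R * (2 * p * a) = a * (4 * p * d%:R) / 2 by field.
rewrite dE in bd; lra.
Qed.

Lemma local_lemma : exists f, forall i, ~~ bad i f.
Proof.
(* Each further event to avoid costs at most a factor [1 - 2 * p], which is positive since
   [4 * p <= 1]. *)
have pos (s : seq I) : 0 < Pr (none [set i in s]).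
  elim: s => [|i s IH].
    rewrite (_ : Pr _ = 1) ?ltr01// -[RHS](expect_cst w_sum1 1).
    apply: expect_eq => f; rewrite (_ : none _ f)//.
    by apply/forall_inP => j; rewrite inE in_nil.
  apply: (@lt_le_trans _ _ ((1 - 2 * p) * Pr (none [set i in s]))).
    rewrite pmulr_lgt0//.
    have : 1 <= d%:R :> R by rewrite (ler_nat _ 1).
    by move: (p_ge0 i) pd_le => *; nra.
  rewrite mulrBl mul1r lerBlDr.
  apply: le_trans (lerD (lexx _) (cond_le i [set j in s])).
  rewrite -expectD; apply: expect_le => // f.
  case: (boolP (none [set j in s] f)) => [ns|_]; last by rewrite addr_ge0.
  case: (boolP (bad i f)) => bi /=; first by rewrite lerDr.
  rewrite (_ : none _ f) ?lerDl//; apply/forall_inP => j; rewrite !inE.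
  by case/orP => [/eqP->//|js]; move/forall_inP: ns; apply; rewrite inE.
have [/existsP[f /forallP nf]|nf] := boolP [exists f, [forall i, ~~ bad i f]].
  by exists f.
suff : Pr (none [set i in enum I]) = 0 by have := pos (enum I); lra.
rewrite -[RHS](expect_cst w_sum1 0); apply: expect_eq => f.
case: (boolP (none _ f)) => // /forall_inP nF; case/negP: nf.
apply/existsP; exists f; apply/forallP => i; apply: nF.
by rewrite inE mem_enum.
Qed.

End LocalLemma.

(** * Negative correlation and convexity of products *)

Section OneHot.
Context {R : realFieldType} {T : finType}.
Variables (w : T -> R) (kappa : T -> nat).
Hypothesis w_ge0 : forall t, 0 <= w t.
Hypothesis w_sum1 : \sum_t w t = 1.

Let onehot (u delta : nat -> R) (cs : seq nat) t :=
  \prod_(c <- cs) (u c + (kappa t == c)%:R * delta c).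

(* Negative correlation: replacing the one-hot vector [kappa t == c] by
   independent Bernoulli variables can only increase the expectation. *)
Lemma sum_onehot_le (u delta : nat -> R) (cs : seq nat) : uniq cs ->
  (forall c, 0 <= u c) -> (forall c, 0 <= delta c) ->
  \sum_t w t * onehot u delta cs t <=
  \prod_(c <- cs) (u c + (\sum_t w t * (kappa t == c)%:R) * delta c).
Proof.
move=> ucs u0 d0; elim: cs ucs => [_|c cs IH /= /andP[ccs ucs]].
  rewrite big_nil /onehot; under eq_bigr do rewrite big_nil mulr1.
  by rewrite w_sum1.
rewrite big_cons; set EX := \sum_t w t * onehot u delta cs t.
have onehot_ge t : \prod_(c' <- cs) u c' <= onehot u delta cs t.
  by apply: ler_prod => c' _; rewrite u0 lerDl mulr_ge0.
have EX_ge : \prod_(c' <- cs) u c' <= EX.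
  rewrite -[leLHS]mul1r -[X in X * _]w_sum1 mulr_suml.
  by apply: ler_sum => t _; rewrite ler_wpM2l.
have pc0 : 0 <= \sum_t w t * (kappa t == c)%:R.
  by apply: sumr_ge0 => t _; rewrite mulr_ge0.
apply: (@le_trans _ _
    ((u c + (\sum_t w t * (kappa t == c)%:R) * delta c) * EX)).
  rewrite mulrDl {1}/EX mulr_sumr -mulrA mulr_suml -big_split/=.
  apply: ler_sum => t _; rewrite /onehot big_cons -/(onehot u delta cs t).
  set k := (kappa t == c)%:R; set X := onehot _ _ _ _.
  (* If [kappa t] is [c], it is no colour of [cs], so all indicators in [X] vanish and [X] takes its
     least value, the product of the [u c']. *)
  suff kX : k * X <= k * EX.
    rewrite -subr_ge0 [leRHS](_ : _ = w t * delta c * (k * EX - k * X)).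
      by rewrite !mulr_ge0// subr_ge0.
    by ring.
  rewrite {}/k; case: (eqVneq (kappa t) c) => [tc|_]; last by rewrite !mul0r.
  rewrite !mul1r; apply: le_trans EX_ge.
  rewrite le_eqVlt; apply/orP; left; apply/eqP.
  apply: eq_big_seq => c' c'cs; case: eqP => [tc'|_]; last by rewrite mul0r addr0.
  by move: ccs; rewrite -tc tc' c'cs.
by rewrite ler_wpM2l ?IH// addr_ge0// mulr_ge0.
Qed.

End OneHot.

Section Chord.
Context {R : realFieldType} {I : Type}.
Variables (a : pred I) (r : I -> R).
Hypothesis r01 : forall i, 0 <= r i <= 1.

Let g (s : seq I) (x : R) := \prod_(i <- s) (1 - (if a i then x else 1) * r i).

Lemma prod_chord_ge0 s x : 0 <= x <= 1 -> 0 <= g s x <= 1.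
Proof.
move=> x01; apply/andP; split.
  apply: prodr_ge0 => i _; have := r01 i; case: (a i); nra.
apply: prodr_ile1 => i _; have := r01 i; case: (a i) => /=; nra.
Qed.

Lemma prod_chord_anti s : g s 1 <= g s 0.
Proof.
apply: ler_prod => i _; have := r01 i.
by case: (a i) => ?; apply/andP; split; lra.
Qed.

(** A product of nonnegative nonincreasing affine functions is convex. Inductively, multiplying the
    chord by one more factor in [x] stays below the new chord, by exactly
    [x * (1 - x) * p * (g0 - g1)]. *)
Lemma prod_chord_le s x : 0 <= x <= 1 -> g s x <= x * g s 1 + (1 - x) * g s 0.
Proof.
move=> x01; elim: s => [|i s IH]; first by rewrite /g !big_nil; lra.
rewrite /g !big_cons -!/(g s _).
have := prod_chord_anti s; have := prod_chord_ge0 s x01.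
have i1 : 0 <= (1 : R) <= 1 by rewrite ler01 lexx.
have i0 : 0 <= (0 : R) <= 1 by rewrite ler01 lexx.
have := prod_chord_ge0 s i1; have := prod_chord_ge0 s i0 => {i0 i1}.
move: IH; have := r01 i; set p := r i.
move: (g s x) (g s 0) (g s 1) => gx g0 g1 p01 IH g001 g101 gx01 g10.
case: (a i); last by nra.
apply: (@le_trans _ _ ((1 - x * p) * (x * g1 + (1 - x) * g0))).
  by rewrite ler_wpM2l//; nra.
rewrite -subr_ge0.
rewrite (_ : _ - _ = x * (1 - x) * p * (g0 - g1)); last by ring.
by rewrite !mulr_ge0//; lra.
Qed.

End Chord.

(** * Probability that every colour of a list is blocked *)

Section CoverEstimate.
Context {R : realFieldType} {V T : finType}.
Variables (w : V -> T -> R) (col : V -> T -> nat).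
Hypothesis w_ge0 : forall v t, 0 <= w v t.
Hypothesis w_sum1 : forall v, \sum_t w v t = 1.
Implicit Types (y : V -> nat -> R) (f : {ffun V -> T}).

Definition col_prob v c : R := \sum_t w v t * (col v t == c)%:R.

Definition point_mass (c : nat) : nat -> R := fun c' => (c == c')%:R.

Definition update_row y v (row : nat -> R) : V -> nat -> R :=
  fun u => if u == v then row else y u.

Definition unit_rows y := forall v c, 0 <= y v c <= 1.

Lemma col_prob01 : unit_rows col_prob.
Proof.
move=> v c; apply/andP; split; first by apply: sumr_ge0 => t _; rewrite mulr_ge0.
rewrite -[leRHS](w_sum1 v); apply: ler_sum => t _.
by rewrite ler_piMr// lern1; case: (_ == _).
Qed.

Lemma point_mass01 c c' : 0 <= point_mass c c' <= 1.
Proof. by rewrite /point_mass; case: (_ == _); rewrite ?lexx ?ler01. Qed.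

(** Hybrid argument: in [rows s f] the vertices of [s] carry their sampled colour and the others
    their mean row; they are averaged one at a time. *)
Lemma expect_le_rows (G : (V -> nat -> R) -> R) :
  (forall v y, unit_rows y ->
    \sum_t w v t * G (update_row y v (point_mass (col v t))) <=
    G (update_row y v (col_prob v))) ->
  expect w (fun f => G (fun v => point_mass (col v (f v)))) <= G col_prob.
Proof.
move=> G_step.
pose rows (s : seq V) (f : {ffun V -> T}) v :=
  if v \in s then point_mass (col v (f v)) else col_prob v.
suff h s : uniq s -> expect w (fun f => G (rows s f)) <= G col_prob.
  have := h (enum V) (enum_uniq V); congr (_ <= _); apply: expect_eq => f.
  by congr G; apply/funext => v; rewrite /rows mem_enum.
elim: s => [_|v s IH /= /andP[vs us]].
  by rewrite -[leRHS](expect_cst w_sum1); apply: expect_le.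
apply: le_trans (IH us).
have rows_dep t : depends_on (~: [set v])
    (fun f => G (update_row (rows s f) v (point_mass (col v t)))).
  move=> f g fg; congr G; apply/funext => u; rewrite /update_row /rows.
  by case: eqVneq => // uv; rewrite fg// !inE.
apply: (@le_trans _ _ (expect w (fun f => \sum_t w v t *
    G (update_row (rows s f) v (point_mass (col v t)))))); last first.
  apply: expect_le => // f; apply: le_trans (G_step _ _ _) _.
    move=> u c; rewrite /rows; case: ifP => _; first exact: point_mass01.
    exact: col_prob01.
  rewrite le_eqVlt; apply/orP; left; apply/eqP; congr G; apply/funext => u.
  by rewrite /update_row /rows; case: eqVneq => // ->; rewrite (negPf vs).
rewrite le_eqVlt; apply/orP; left; apply/eqP.
(* Splitting on the value of [f v] leaves, by [rows_dep], a factor independent of it, so that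
   [expectM] applies. *)
transitivity (expect w (fun f => \sum_t (f v == t)%:R *
    G (update_row (rows s f) v (point_mass (col v t))))).
  apply: expect_eq => f; rewrite (bigD1 (f v))//= eqxx mul1r big1 ?addr0.
    congr G; apply/funext => u; rewrite /update_row /rows inE.
    by case: eqVneq => // ->.
  by move=> t; rewrite eq_sym => /negPf ->; rewrite mul0r.
rewrite !expect_sum; apply: eq_bigr => t _.
rewrite (expectM w_sum1 (S := [set v])) => [||//]; last first.
  by move=> f g fg; rewrite fg ?inE.
rewrite (expect_row w_sum1 v (fun t' => (t' == t)%:R)).
rewrite (bigD1 t)//= eqxx mulr1 big1 ?addr0; last first.
  by move=> t' /negPf->; rewrite mulr0.
by rewrite expectZ.
Qed.

(* A pessimistic estimator of [covered]: exact on [point_mass] rows, and not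
   decreased by averaging one row, so that its value at [col_prob] bounds the
   probability of [covered]. *)
Definition cover_est (F : seq {set V}) (cs : seq nat) y : R :=
  \prod_(c <- cs) (1 - \prod_(e <- F) (1 - \prod_(v in e) y v c)).

Definition covered (F : seq {set V}) (cs : seq nat) f :=
  all (fun c => has (fun e : {set V} => [forall v in e, col v (f v) == c]) F) cs.

Lemma cover_est_point_mass F cs f :
  cover_est F cs (fun v => point_mass (col v (f v))) = (covered F cs f)%:R.
Proof.
have prodE (e : {set V}) c : \prod_(v in e) point_mass (col v (f v)) c =
    [forall v in e, col v (f v) == c]%:R.
  case: (boolP [forall v in e, _]) => [/forall_inP h|/forall_inPn[v ve h]].
    by rewrite big1// => v ve; rewrite /point_mass h.
  by rewrite (bigD1 v)//= /point_mass (negPf h) mul0r.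
elim: cs => [|c cs IH]; first by rewrite /cover_est big_nil.
rewrite /cover_est big_cons -/(cover_est F cs _) IH /= -mulnb natrM.
congr (_ * _); elim: F {IH} => [|e F IH] /=; first by rewrite big_nil subrr.
rewrite big_cons prodE; case: [forall v in e, _] => /=.
  by rewrite subrr mul0r subr0.
by rewrite subr0 mul1r.
Qed.

(** On a point mass each factor is affine in the indicator of its colour. [sum_onehot_le] decouples
    the colours, and [prod_chord_le] replaces the interpolation between [g c 0] and [g c 1] by the
    value of [g c] at the mean. *)
Lemma expect_covered_le F cs : uniq cs ->
  expect w (fun f => (covered F cs f)%:R) <= cover_est F cs col_prob.
Proof.
move=> ucs.
under [leLHS]expect_eq do rewrite -cover_est_point_mass.
apply: expect_le_rows => v y y01.
pose rest c (e : {set V}) := \prod_(u in e | u != v) y u c.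
have rest01 c e : 0 <= rest c e <= 1.
  rewrite prodr_ge0 ?prodr_ile1//= => u _; first by have /andP[] := y01 u c.
pose g c x := \prod_(e <- F) (1 - (if v \in e then x else 1) * rest c e).
have estE row : cover_est F cs (update_row y v row) =
    \prod_(c <- cs) (1 - g c (row c)).
  apply: eq_bigr => c _; congr (1 - _); apply: eq_bigr => e _; congr (1 - _).
  have off u : u != v -> update_row y v row u c = y u c.
    by move=> /negPf uv; rewrite /update_row uv.
  case: ifPn => ve.
    rewrite (bigD1 v)//= {1}/update_row eqxx; congr (_ * _).
    by apply: eq_bigr => u /andP[_ /off].
  rewrite mul1r; apply: eq_big => [u|u ue].
    by case: (eqVneq u v) => [->|]; rewrite ?andbT ?andbF ?(negPf ve).
  by apply: off; apply: contraNneq ve => <-.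
rewrite estE; under [leLHS]eq_bigr do rewrite estE.
have g_mono c : g c 1 <= g c 0 by exact: prod_chord_anti.
have g01 c x : 0 <= x <= 1 -> 0 <= g c x <= 1 by move=> ?; exact: prod_chord_ge0.
have i0 : 0 <= (0 : R) <= 1 by rewrite ler01 lexx.
apply: le_trans (_ : _ <= \prod_(c <- cs)
    (1 - g c 0 + col_prob v c * (g c 0 - g c 1))) _.
  apply: le_trans (sum_onehot_le (col v) (w_ge0 v) (w_sum1 v)
    (u := fun c => 1 - g c 0) (delta := fun c => g c 0 - g c 1) ucs _ _).
  - apply: ler_sum => t _; apply: ler_wpM2l => //.
    rewrite le_eqVlt; apply/orP; left; apply/eqP; apply: eq_bigr => c _.
    by rewrite /point_mass; case: (_ == _) => /=; ring.
  - by move=> c; have := g01 c _ i0; lra.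
  - by move=> c; have := g_mono c; lra.
apply: ler_prod => c _; have := g01 c _ i0; have := g_mono c.
have p01 := col_prob01 v c.
have : g c (col_prob v c) <= col_prob v c * g c 1 + (1 - col_prob v c) * g c 0.
  exact: prod_chord_le.
by move=> *; apply/andP; split; nra.
Qed.

End CoverEstimate.

(** * Exponential bound on the estimator *)

Lemma expRN_le_1B {R : realType} (tau x : R) : tau < 1 -> 0 <= x <= tau ->
  expR (- (x / (1 - tau))) <= 1 - x.
Proof.
move=> tau_lt1 x01; rewrite expRN invf_ple ?posrE ?expR_gt0//; last by lra.
apply: le_trans (expR_ge1Dx _).
rewrite -div1r ler_pdivrMr; last by lra.
rewrite -subr_ge0.
have -> : (1 + x / (1 - tau)) * (1 - x) - 1 = x * (tau - x) / (1 - tau).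
  by field; lra.
by rewrite divr_ge0 ?mulr_ge0//; lra.
Qed.

Section CoverEstimateBound.
Context {R : realType} {V : finType}.
Variables (F : seq {set V}) (cs : seq nat) (y : V -> nat -> R).
Variables (rho : nat -> R) (rho_max tau Lambda : R).
Hypothesis rho_ge0 : forall c, 0 <= rho c.
Hypothesis rho_le : forall c, rho c <= rho_max.
Hypothesis rho_max_gt0 : 0 < rho_max.
Hypothesis rho_sum1 : \sum_(c <- cs) rho c = 1.
Hypothesis tau_lt1 : tau < 1.
Let load (e : {set V}) c := \prod_(v in e) y v c.
Hypothesis load_bound : forall e c, e \in F -> 0 <= load e c <= tau.
Hypothesis load_sum : \sum_(e <- F) \sum_(c <- cs) rho c * load e c <= Lambda.

(* Jensen's inequality for [rho], in the form of the tangent line of [exp]. *)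
Lemma cover_est_bound :
  cover_est F cs y <= expR (- (rho_max^-1 * expR (- (Lambda / (1 - tau))))).
Proof.
pose x c := (\sum_(e <- F) load e c) / (1 - tau).
have factor c : 1 - \prod_(e <- F) (1 - load e c) <= expR (- expR (- x c)).
  apply: le_trans (expR_ge1Dx _); rewrite lerD2l lerN2.
  rewrite /x mulr_suml -sumrN expR_sum.
  rewrite big_seq_cond [leRHS]big_seq_cond; apply: ler_prod => e /andP[eF _].
  by rewrite expR_ge0/= expRN_le_1B ?load_bound.
apply: (@le_trans _ _ (\prod_(c <- cs) expR (- expR (- x c)))).
  apply: ler_prod => c _; rewrite factor andbT subr_ge0.
  rewrite big_seq_cond; apply: prodr_ile1 => e /andP[eF _].
  by rewrite -/(load e c); move: (load_bound c eF) tau_lt1; lra.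
rewrite -expR_sum ler_expR sumrN lerN2.
have Lx : \sum_(c <- cs) rho c * x c <= Lambda / (1 - tau).
  rewrite /x; under eq_bigr do rewrite mulrA mulr_sumr.
  by rewrite -mulr_suml exchange_big ler_pM2r// invr_gt0 subr_gt0.
set a := Lambda / _ in Lx *.
rewrite ler_pdivrMl//; apply: (@le_trans _ _ (\sum_(c <- cs) rho c *
    (expR (- a) * (1 + a - x c)))).
  under eq_bigr do rewrite mulrCA; rewrite -mulr_sumr ler_peMr ?expR_ge0//.
  under eq_bigr do rewrite mulrBr; rewrite sumrB -mulr_suml rho_sum1.
  by lra.
rewrite mulr_sumr; apply: ler_sum => c _.
apply: (@le_trans _ _ (rho c * expR (- x c))); last first.
  by rewrite ler_wpM2r ?expR_ge0.
have -> : expR (- x c) = expR (- a) * expR (a - x c).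
  by rewrite -expRD; congr expR; ring.
rewrite ler_wpM2l//; apply: ler_wpM2l; first exact: expR_ge0.
by rewrite -addrA; exact: expR_ge1Dx.
Qed.
End CoverEstimateBound.

(** * The random colouring and its bad events *)

Lemma card_bigcup_le (I T : finType) (P : pred I) (F : I -> {set T}) :
  (#|\bigcup_(i | P i) F i| <= \sum_(i | P i) #|F i|)%N.
Proof.
elim/big_rec2: _ => [|i n X _ Xn]; first by rewrite cards0.
by apply: leq_trans (leq_card_setU _ _) _; rewrite leq_add2l.
Qed.

Lemma sum_nth_eq_le {R : realFieldType} (q : nat) (s : seq nat) (w : nat -> R)
    (M : R) (c : nat) : uniq s -> (q <= size s)%N -> 0 <= M ->
  (forall i, w i <= M) -> \sum_(i < q) w i * (nth 0%N s i == c)%:R <= M.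
Proof.
move=> us qs M0 wM.
have [/existsP[i /eqP ic]|nc] := boolP [exists i : 'I_q, nth 0%N s i == c].
  rewrite (bigD1 i)//= ic eqxx mulr1 big1 ?addr0// => j ji.
  rewrite -ic nth_uniq ?(leq_trans (ltn_ord _) qs)//.
  by move: ji; rewrite -val_eqE => /= /negPf->; rewrite mulr0.
rewrite big1// => i _; case: eqP => [ic|_]; last by rewrite mulr0.
by case/negP: nc; apply/existsP; exists i; apply/eqP.
Qed.

Section Coloring.
Context {R : realType}.
Variables (H : hypergraph) (k Delta m : nat) (A B : {set H}).
Variable s : H -> seq nat.
Let q := (16 * m)%N.
Hypothesis m_gt0 : (0 < m)%N.
Hypothesis k_ge2 : (2 <= k)%N.
Hypothesis H_unif : uniform k H.
Hypothesis H_deg : (max_degree H <= Delta)%N.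
Hypothesis eA : forall e, e \in edges H -> #|e :&: A| = 1%N.
Hypothesis eB : forall e, e \in edges H -> #|e :&: B| = 1%N.
Hypothesis AB : [disjoint A & B].
Hypothesis s_sorted : forall v, sorted ltn (s v).
Hypothesis s_size : forall v, size (s v) = q.

Let S : R := \sum_(j < 16) cbw j.
(** Ratio of the largest weight used on [A], [1 / (m * S) = C / q], to the uniform weight
    [1 / q]. *)
Let C : R := (2 * cbw 16)^-1.

Let S_gt0 : 0 < S.
Proof. by rewrite /S sum_cbw !mulr_gt0 ?cbw_gt0. Qed.

Let mR_gt0 : 0 < m%:R :> R.
Proof. by rewrite ltr0n. Qed.

Let qR_gt0 : 0 < q%:R :> R.
Proof. by rewrite ltr0n muln_gt0. Qed.

Let mS : m%:R * S = q%:R / C.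
Proof.
by rewrite /S /C sum_cbw /q natrM invrK; ring.
Qed.

Let C_ge1 : 1 <= C.
Proof.
rewrite /C -invr1 lef_pV2 ?posrE ?mulr_gt0 ?cbw_gt0//.
have -> : cbw 16 = cbw 1 * (cbw 16 / cbw 1) :> R.
  by rewrite mulrCA divff ?mulr1// gt_eqF ?cbw_gt0.
have : cbw 16 / cbw 1 <= 1 :> R.
  by rewrite ler_pdivrMr ?cbw_gt0// mul1r cbw_le.
by rewrite /= mulr0 add0r add0r mul1r; lra.
Qed.

Let w (v : H) (i : 'I_q) : R :=
  if v \in A then blockw m i / (m%:R * S) else q%:R^-1.

Let col (v : H) (i : 'I_q) := nth 0%N (s v) i.

Let w_ge0 v i : 0 <= w v i.
Proof.
rewrite /w; case: ifP => _; last by rewrite invr_ge0 ltW.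
by rewrite divr_ge0 ?blockw_ge0// ltW// mulr_gt0.
Qed.

Let sum_rank_weight : \sum_(i < q) blockw m i / (m%:R * S) = 1.
Proof.
by rewrite -mulr_suml /q sum_blockw// divff// gt_eqF// mulr_gt0.
Qed.

Let w_sum1 v : \sum_i w v i = 1.
Proof.
rewrite /w; case: (v \in A); first exact: sum_rank_weight.
by rewrite sumr_const card_ord -[LHS]mulr_natl divff// gt_eqF.
Qed.

Let s_uniq v : uniq (s v).
Proof. exact: sorted_uniq ltn_trans ltnn _ (s_sorted v). Qed.

Let y := col_prob w col.

Let weight_le i : blockw m i / (m%:R * S) <= C / q%:R.
Proof.
rewrite mS invf_div -[leRHS]mul1r ler_wpM2r ?blockw_le1//.
by rewrite divr_ge0 ?ltW// (lt_le_trans ltr01).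
Qed.

Let y_A v c : v \in A -> y v c <= C / q%:R.
Proof.
move=> vA; rewrite /y /col_prob /w vA.
apply: (@sum_nth_eq_le _ q (s v) (fun i => blockw m i / (m%:R * S))) => //.
  by rewrite s_size.
by rewrite divr_ge0 ?ltW// (lt_le_trans ltr01).
Qed.

Let y_notA v c : v \notin A -> y v c <= q%:R^-1.
Proof.
move=> /negPf vA; rewrite /y /col_prob /w vA.
apply: (@sum_nth_eq_le _ q (s v) (fun=> q%:R^-1)) => //.
  by rewrite s_size.
Qed.

Let star (v : H) := [set e in edges H | v \in e].
Let links (b : H) : seq {set H} := [seq e :\ b | e <- enum (star b)].

Let star_le v : (#|star v| <= Delta)%N.
Proof. by apply: leq_trans H_deg; rewrite /max_degree (bigD1 v)//= leq_maxl. Qed.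

(** Not a sampling law: these are the averaging weights for [cover_est_bound], reversed in rank so
    that [blockw_overlap] applies against a vertex of [A]. *)
Let rho (b : H) c : R :=
  blockw m (q.-1 - index c (s b))%N / (m%:R * S).

Let rho_sum1 b : \sum_(c <- s b) rho b c = 1.
Proof.
rewrite (big_nth 0%N) big_mkord s_size -sum_rank_weight.
rewrite [RHS](reindex_inj rev_ord_inj)/=; apply: eq_bigr => -[j jq] _ /=.
rewrite /rho index_uniq ?s_size//; congr (blockw m _ / _).
by case: (q) jq => // q' _; rewrite subSS.
Qed.

Let y01 := col_prob01 col w_ge0 w_sum1.

(** Besides [b] and its vertex [a] in [A], the edge has [k - 2] vertices, all coloured uniformly. *)
Let load_le b e : b \in B -> e \in star b -> exists2 a, a \in A &
  forall c, \prod_(v in e :\ b) y v c <= y a c * q%:R^-1 ^+ k.-2.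
Proof.
move=> bB; rewrite inE => /andP[eE be].
have /eqP/cards1P[a ea] := eA eE.
have /andP[ae aA] : (a \in e) && (a \in A).
  have : a \in e :&: A by rewrite ea !inE.
  by rewrite !inE.
have ab : a != b by apply: contraTneq bB => <-; rewrite (disjointFr AB).
exists a => // c.
rewrite (bigD1 a)/=; last by rewrite !inE ab ae.
rewrite ler_wpM2l//; first by have /andP[] := y01 a c.
have -> : (k.-2 = #|(e :\ b) :\ a|)%N.
  have := cardsD1 b e; have := cardsD1 a (e :\ b).
  by rewrite !inE be ab ae (H_unif eE) => -> ->.
rewrite -prodr_const; rewrite [leLHS](eq_bigl (mem ((e :\ b) :\ a))); last first.
  by move=> v; rewrite !inE andbC.
apply: ler_prod => v; rewrite !inE => /and3P[va vb ve].
have /andP[-> _] /= := y01 v c.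
apply: y_notA; apply: contraNN va => vA.
have : v \in e :&: A by rewrite !inE ve vA.
by rewrite ea !inE.
Qed.

(** The gain over uniform weights: [blockw_overlap] bounds the sum of [rho b c * y a c] by
    [m / (m * S) ^ 2 = 16 / S ^ 2 / q], and [cbw16] applies. *)
Let load_sum b e : b \in B -> e \in star b ->
  \sum_(c <- s b) rho b c * \prod_(v in e :\ b) y v c <=
  4 / 5 / q%:R ^+ k.-1.
Proof.
move=> bB /(load_le bB)[a aA rest_le].
have rho_ge0 c : 0 <= rho b c.
  by rewrite divr_ge0 ?blockw_ge0// ltW// mulr_gt0.
apply: (@le_trans _ _ (\sum_(c <- s b) rho b c * y a c * q%:R^-1 ^+ k.-2)).
  by apply: ler_sum => c _; rewrite -mulrA ler_wpM2l.
rewrite -mulr_suml.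
have -> : 4 / 5 / q%:R ^+ k.-1 = (4 / 5 / q%:R) * q%:R^-1 ^+ k.-2 :> R.
  by rewrite exprVn -[RHS]mulrA -invfM -exprS; case: k k_ge2 => [|[]].
apply: ler_wpM2r; first by rewrite exprn_ge0 ?invr_ge0 ?ltW.
have key : \sum_(c <- s b) rho b c * y a c <= m%:R / (m%:R * S) ^+ 2.
  rewrite ler_pdivlMr ?exprn_gt0 ?mulr_gt0// mulr_suml.
  rewrite (big_nth 0%N) big_mkord s_size.
  have := blockw_overlap (R := R) m_gt0 (s_sorted a) (s_sorted b).
  rewrite !s_size => overlap_le; apply: le_trans overlap_le.
  rewrite le_eqVlt; apply/orP; left; apply/eqP; apply: eq_bigr => -[j jq] _ /=.
  rewrite /rho /y /col_prob /w aA index_uniq ?s_size// mulr_sumr mulr_suml.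
  apply: eq_bigr => i _; rewrite /col.
  by field; rewrite !gt_eqF.
apply: le_trans key _.
rewrite (_ : m%:R / (m%:R * S) ^+ 2 = 16 / S ^+ 2 / q%:R); last first.
  by rewrite /q natrM; field; rewrite !gt_eqF.
apply: ler_wpM2r; first by rewrite invr_ge0 ltW.
rewrite ler_pdivrMr ?exprn_gt0//.
by rewrite /S sum_cbw; have := @cbw16 R; nra.
Qed.

(** No colour is left for [b]. Vertices outside [B] get an impossible event, so that all of [H] can
    index the events. *)
Let bad (b : H) (f : {ffun H -> 'I_q}) :=
  (b \in B) && covered col (links b) (s b) f.

Let support (b : H) : {set H} :=
  [set v | (b \in B) && [exists e in star b, v \in e :\ b]].

Let bad_dep b : depends_on (support b) (bad b).
Proof.
move=> f g fg; rewrite /bad; case: (boolP (b \in B)) => //= bB.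
apply: eq_in_all => c _; apply: eq_in_has => e /mapP[e0 + ->].
rewrite mem_enum => e0b; apply: eq_forallb_in => v ve; rewrite fg//.
by rewrite inE bB/=; apply/existsP; exists e0; rewrite e0b.
Qed.

(** A dependent [b'] is reached through an edge at [b], a vertex of it and an edge at that vertex,
    whose only vertex in [B] is [b']: at most [Delta * k * Delta] ways. *)
Let dep_le b :
  (#|[set b' | ~~ [disjoint support b & support b']]| <= k * Delta ^ 2)%N.
Proof.
apply: (@leq_trans #|\bigcup_(e in star b) \bigcup_(v in e)
    \bigcup_(e' in star v) (e' :&: B)|).
  apply/subset_leq_card/fintype.subsetP => b'; rewrite inE -setI_eq0.
  case/set0Pn => v; rewrite !inE => /andP[/andP[bB /exists_inP[e eb]]].
  rewrite !inE => /andP[_ ve] /andP[b'B /exists_inP[e' eb']].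
  rewrite !inE => /andP[_ ve'].
  apply/bigcupP; exists e => //; apply/bigcupP; exists v => //.
  move: eb'; rewrite inE => /andP[e'E b'e'].
  by apply/bigcupP; exists e'; rewrite !inE ?e'E ?ve' ?b'e' ?b'B.
apply: leq_trans (card_bigcup_le _ _) _.
apply: (@leq_trans (\sum_(e in star b) k * Delta)%N); last first.
  by rewrite sum_nat_const mulnCA leq_mul2l -mulnn leq_mul2r star_le !orbT.
apply: leq_sum => e; rewrite inE => /andP[eE _].
apply: leq_trans (card_bigcup_le _ _) _.
rewrite -(H_unif eE) -sum_nat_const; apply: leq_sum => v _.
apply: leq_trans (card_bigcup_le _ _) _; rewrite -(muln1 Delta).
apply: (@leq_trans (\sum_(e' in star v) 1)%N); last first.
  by rewrite sum_nat_const leq_mul.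
by apply: leq_sum => e'; rewrite inE => /andP[/eB->].
Qed.

Hypothesis Delta_gt0 : (0 < Delta)%N.
Hypothesis q_gtC : C / q%:R < 1.

(** The bound of [cover_est_bound] with [rho_max] and [tau] equal to [C / q] and [Lambda] equal to
    [Delta] times the bound of [load_sum]. *)
Let fail_prob : R := expR (- (q%:R / C *
  expR (- (4 / 5 * Delta%:R / q%:R ^+ k.-1 / (1 - C / q%:R))))).

Hypothesis fail_prob_le : 4 * fail_prob * (k * Delta ^ 2)%:R <= 1.

Let bad_le b : expect w (fun f => (bad b f)%:R) <= fail_prob.
Proof.
have C0 : 0 < C := lt_le_trans ltr01 C_ge1.
have [bB|bB] := boolP (b \in B); last first.
  rewrite (_ : expect _ _ = 0) ?expR_ge0// -[RHS](expect_cst w_sum1).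
  by apply: expect_eq => f; rewrite /bad (negPf bB).
have -> : expect w (fun f => (bad b f)%:R) =
    expect w (fun f => (covered col (links b) (s b) f)%:R).
  by apply: expect_eq => f; rewrite /bad bB.
apply: le_trans (expect_covered_le _ w_ge0 w_sum1 _ (s_uniq b)) _.
rewrite /fail_prob -[q%:R / C]invf_div.
apply: (cover_est_bound (rho := rho b)) => //.
- by move=> c; rewrite divr_ge0 ?blockw_ge0// ltW// mulr_gt0.
- by move=> c; exact: weight_le.
- by rewrite divr_gt0.
- move=> e c /mapP[e0 + ->]; rewrite mem_enum => /(load_le bB)[a aA le].
  apply/andP; split; first by apply: prodr_ge0 => v _; have /andP[] := y01 v c.
  apply: le_trans (le c) _; rewrite -[leRHS]mulr1.
  have /andP[ya0 _] := y01 a c.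
  apply: (ler_pM ya0 _ (y_A c aA)).
    by rewrite exprn_ge0// invr_ge0 ltW.
  apply: exprn_ile1; first by rewrite invr_ge0 ltW.
  by rewrite invf_le1// (ler_nat _ 1) muln_gt0.
rewrite big_map big_enum/=.
apply: (@le_trans _ _ (\sum_(e in star b) (4 / 5 / q%:R ^+ k.-1))).
  by apply: ler_sum => e; exact: load_sum.
rewrite sumr_const -[leLHS]mulr_natl mulrCA -mulrA ler_wpM2l ?divr_ge0//.
rewrite ler_wpM2r ?ler_nat ?star_le//.
Qed.

Lemma exists_coloring_from :
  exists f : H -> nat, proper_coloring f /\ forall v, f v \in s v.
Proof.
have [f0 f0P] : exists f, forall b, ~~ bad b f.
  apply: (local_lemma w_ge0 w_sum1 bad_dep bad_le dep_le fail_prob_le).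
  by rewrite muln_gt0 expn_gt0 Delta_gt0 (ltn_trans _ k_ge2).
pose ok v c := [/\ c \in s v, (v \notin B -> c = col v (f0 v)) &
  (v \in B -> forall e, e \in star v -> exists2 u, u \in e :\ v &
     col u (f0 u) != c)].
have /choice[f fP] : forall v, exists c, ok v c.
  move=> v; have [vB|vB] := boolP (v \in B); last first.
    by exists (col v (f0 v)); split=> [|_ //|/(negP vB)]; rewrite ?mem_nth ?s_size.
  have := f0P v; rewrite /bad vB/= => /allPn[c cs /hasPn hc]; exists c.
  split=> [//||_ e ev]; first by rewrite vB.
  have /hc/forall_inPn[u ue uc] : e :\ v \in links v.
    by apply: map_f; rewrite mem_enum.
  by exists u.
exists f; split=> [c e eE|v]; last by have [] := fP v.
apply/negP => /fintype.subsetP emono.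
(* The contradiction arises at the vertex [b] of the edge in [B]: the others keep their sampled
   colours, and one of these differs from the colour of [b]. *)
have /eqP/cards1P[b eb] := eB eE.
have /andP[be bB] : (b \in e) && (b \in B).
  have : b \in e :&: B by rewrite eb !inE.
  by rewrite !inE.
have [_ _ /(_ bB e)] := fP b; rewrite inE eE be => /(_ isT)[u].
rewrite !inE => /andP[ub ue].
have uB : u \notin B.
  apply: contraNN ub => uB; have : u \in e :&: B by rewrite !inE ue uB.
  by rewrite eb !inE.
have [_ /(_ uB) <- _] := fP u.
move: (emono _ ue) (emono _ be); rewrite !inE => /eqP-> /eqP->.
by rewrite eqxx.
Qed.

End Coloring.

(** * Asymptotics of the failure probability *)

Lemma bernoulli_ineq {R : realDomainType} (x : R) n : x <= 1 ->
  1 - n%:R * x <= (1 - x) ^+ n.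
Proof.
move=> x1; elim: n => [|n IH]; first by rewrite mul0r subr0 expr0.
have [x0|x0] := leP 0 x.
  rewrite exprS -natr1; apply: (@le_trans _ _ ((1 - x) * (1 - n%:R * x))).
    by have := ler0n R n; nra.
  by rewrite ler_wpM2l// subr_ge0.
rewrite exprS; apply: (@le_trans _ _ ((1 - x) * (1 - n%:R * x))).
  by rewrite -natr1; have := ler0n R n; nra.
by rewrite ler_wpM2l// subr_ge0.
Qed.

Lemma half_sqr_le_expR {R : realType} (x : R) : 0 <= x -> x ^+ 2 / 2 <= expR x.
Proof.
move=> x0; have := expR_ge1Dxn 1 x0; rewrite (_ : 2`! = 2)%N //.
by apply: le_trans; rewrite lerDr.
Qed.

(** To be used with [L = ln Delta], [n = k - 1], [K = k], [Q] the claimed bound and [q] its rounding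
    to a multiple of 16. The inner exponential is at least [Delta ^ (- 1 / (n + eps / 2))], while
    [q] exceeds a larger power of [Delta]; the product beats [2 * L + ln (4 * K)]. *)
Lemma fail_prob_asymp {R : realType} (C eps K : R) (n : nat) :
  0 < C -> 0 < eps -> (0 < n)%N -> 1 <= K ->
  exists2 L0 : R, 0 < L0 & forall L Q q : R, L0 <= L -> 0 <= Q ->
    Q ^+ n = 4 / 5 * (n%:R + eps) * (expR L / L) -> Q - 16 <= q ->
    [/\ 0 < q, C / q < 1 &
      4 * expR (- (q / C *
        expR (- (4 / 5 * expR L / q ^+ n / (1 - C / q))))) *
      (K * expR L ^+ 2) <= 1].
Proof.
move=> C0 eps0 n0 K1.
have n1 : 1 <= n%:R :> R by rewrite (ler_nat _ 1).
(* [lam] is an exponent below [1 / n] with [Q >= exp (lam * L)], and [nu] is the slack that absorbs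
   the factor [1 / L]. [mu] is the final margin in the exponent. The relative loss [theta] turns
   [n + eps] into [n + eps / 2], and [Q >= Q0] keeps the rounding within it. *)
pose lam : R := (n%:R + eps / 4)^-1.
pose mu : R := lam - (n%:R + eps / 2)^-1.
pose nu : R := 1 - n%:R * lam.
pose theta : R := eps / (2 * (n%:R + eps)).
pose Q0 : R := n%:R * (16 + C) / theta.
have lam0 : 0 < lam by rewrite invr_gt0; lra.
have mu0 : 0 < mu by rewrite subr_gt0 ltf_pV2 ?posrE; lra.
have nu0 : 0 < nu.
  rewrite subr_gt0 -ltr_pdivlMr// mul1r invrK; lra.
have theta0 : 0 < theta by rewrite divr_gt0//; lra.
have theta1 : theta <= 1 / 2 by rewrite ler_pdivrMr; lra.
have Q0_ge : 32 + 2 * C <= Q0.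
  rewrite ler_pdivlMr//; nra.
have lnK0 : 0 <= ln (4 * K) by rewrite ln_ge0//; lra.
have a0 : 0 <= 12 * C / mu ^+ 2 by rewrite divr_ge0 ?sqr_ge0//; lra.
have b0 : 0 <= 5 / 2 / nu ^+ 2 by rewrite divr_ge0 ?sqr_ge0.
have c0 : 0 <= Q0 / lam by rewrite divr_ge0//; lra.
(* All summands are nonnegative, so [L] exceeds each one. The constants 12 and 5/2 are what
   [exp x >= x ^ 2 / 2] requires in [main] and [Qlam]. *)
exists (1 + ln (4 * K) + 12 * C / mu ^+ 2 + 5 / 2 / nu ^+ 2 + Q0 / lam).
  lra.
move=> L Q q LL0 Q_ge0 QE Qq.
have L1 : 1 <= L by lra.
have Lmu : 12 * C <= L * mu ^+ 2 by rewrite -ler_pdivrMr ?exprn_gt0//; lra.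
have Lnu : 5 / 2 <= L * nu ^+ 2 by rewrite -ler_pdivrMr ?exprn_gt0//; lra.
have LQ : Q0 <= L * lam by rewrite -ler_pdivrMr//; lra.
have LK : ln (4 * K) <= L by lra.
have Qlam : expR (lam * L) <= Q.
  rewrite -(@ler_pXn2r _ n)// ?nnegrE ?expR_ge0// QE -expRM_natl.
  have -> : n%:R * (lam * L) = - (nu * L) + L by rewrite /nu; ring.
  rewrite expRD expRN mulrA mulrAC ler_wpM2r ?expR_ge0//.
  rewrite ler_pdivlMr; last by lra.
  rewrite ler_pdivrMl ?expR_gt0//.
  have nuL : 0 <= nu * L by rewrite mulr_ge0; lra.
  have := half_sqr_le_expR nuL; set E := expR _; rewrite exprMn => hE.
  nra.
have QQ0 : Q0 <= Q.
  apply: le_trans LQ _; apply: le_trans Qlam.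
  by have := expR_ge1Dx (lam * L); lra.
have qC : C < q by lra.
have q0 : 0 < q by lra.
have Cq : C / q < 1 by rewrite ltr_pdivrMr// mul1r.
split=> //.
have Qpos : 0 < Q by lra.
(* Since [q ^ n * (1 - C / q) = q ^ (n - 1) * (q - C)], both losses fit into [(Q - (16 + C)) ^ n],
   to which Bernoulli's inequality applies. *)
have loss : Q ^+ n * (1 - theta) <= q ^+ n * (1 - C / q).
  apply: (@le_trans _ _ ((Q - (16 + C)) ^+ n)).
    have -> : Q - (16 + C) = Q * (1 - (16 + C) / Q) by field; lra.
    rewrite exprMn ler_wpM2l ?exprn_ge0//.
    have KQ : (16 + C) / Q <= 1 by rewrite ler_pdivrMr; lra.
    apply: le_trans _ (bernoulli_ineq _ KQ); rewrite lerD2l lerN2 mulrA ler_pdivrMr//.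
    by rewrite [theta * Q]mulrC -ler_pdivrMr.
  apply: (@le_trans _ _ ((q - C) ^+ n)).
    by rewrite lerXn2r ?nnegrE; lra.
  case: n n0 {n1 lam mu nu theta Q0 lam0 mu0 nu0 theta0 theta1 Q0_ge a0 b0 c0
    LL0 QE Lmu Lnu LQ Qlam QQ0} => // n _.
  rewrite !exprSr -mulrA ler_pM ?exprn_ge0//; try lra.
    by rewrite lerXn2r ?nnegrE; lra.
  by rewrite mulrBr mulr1 mulrCA divff ?mulr1// gt_eqF.
have E0 := expR_gt0 L.
have QnE : Q ^+ n * (1 - theta) = 4 / 5 * (n%:R + eps / 2) * (expR L / L).
  by rewrite QE /theta; field; apply/andP; split; lra.
have Qn0 : 0 < Q ^+ n * (1 - theta).
  by rewrite mulr_gt0 ?exprn_gt0//; lra.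
have expo : 4 / 5 * expR L / q ^+ n / (1 - C / q) <= L / (n%:R + eps / 2).
  rewrite -mulrA -invfM.
  apply: (@le_trans _ _ (4 / 5 * expR L / (Q ^+ n * (1 - theta)))).
    rewrite ler_pM2l ?mulr_gt0// lef_pV2 ?posrE//.
    exact: lt_le_trans Qn0 loss.
  rewrite le_eqVlt; apply/orP; left; apply/eqP; rewrite QnE.
  by field; rewrite (gt_eqF E0)/=; apply/andP; split; lra.
have main : 2 * L + ln (4 * K) <= q / C * expR (- (L / (n%:R + eps / 2))).
  apply: (@le_trans _ _ (3 * L)); first by lra.
  apply: (@le_trans _ _ (expR (mu * L) / (2 * C))).
    have muL : 0 <= mu * L by rewrite mulr_ge0; lra.
    rewrite ler_pdivlMr ?mulr_gt0//.
    have := half_sqr_le_expR muL; set E := expR _; rewrite exprMn => hE.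
    nra.
  have -> : mu * L = lam * L - L / (n%:R + eps / 2) by rewrite /mu; ring.
  rewrite expRD mulrAC ler_wpM2r ?expR_ge0//.
  by rewrite invfM mulrA ler_wpM2r ?invr_ge0 ?ltW//; lra.
rewrite (_ : 4 * _ * _ = expR (- (q / C *
    expR (- (4 / 5 * expR L / q ^+ n / (1 - C / q)))) +
    (2 * L + ln (4 * K)))).
  rewrite -[leRHS]expR0 ler_expR [leLHS]addrC subr_le0; apply: le_trans main _.
  by rewrite ler_wpM2l ?ler_expR ?lerN2// divr_ge0// ltW.
rewrite !expRD expRM_natl lnK ?posrE; last by lra.
by ring.
Qed.

(** * From arbitrary lists to the choice number *)

Lemma exists_sorted_sublist (A : set nat) (n q : nat) :
  (`I_n #<= A)%card -> (q <= n)%N ->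
  exists s : seq nat, [/\ sorted ltn s, size s = q & forall c, c \in s -> A c].
Proof.
move=> An qn.
suff [s [us sq sA]] : exists s : seq nat,
    [/\ uniq s, size s = q & forall c, c \in s -> A c].
  exists (sort leq s); split; last by move=> c; rewrite mem_sort => /sA.
    by rewrite ltn_sorted_uniq_leq sort_uniq us (sort_sorted leq_total).
  by rewrite size_sort.
elim: q qn => [_|q IH qn]; first by exists [::].
have [s [us sq sA]] := IH (ltnW qn).
have [c Ac cs] : exists2 c, A c & c \notin s.
  by apply: card_le_fresh An _; rewrite sq.
exists (c :: s); split; rewrite /= ?cs ?sq// => c'.
by rewrite inE => /orP[/eqP->//|/sA].
Qed.

Lemma partite_choosable {R : realType} (H : hypergraph) (k Delta m n : nat)
    (q := (16 * m)%N) (C : R := (2 * cbw 16)^-1) :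
  (2 <= k)%N -> uniform k H -> partite k H -> (max_degree H <= Delta)%N ->
  (0 < Delta)%N -> (0 < m)%N -> (q <= n)%N -> C / q%:R < 1 ->
  4 * expR (- (q%:R / C *
    expR (- (4 / 5 * Delta%:R / q%:R ^+ k.-1 / (1 - C / q%:R)))))
    * (k * Delta ^ 2)%:R <= 1 ->
  choosable H n.
Proof.
move=> k2 Hu [P [Puniq Pe]] Hd D0 m0 qn Cq fail L Ln.
have [s sP] := choice (fun v => exists_sorted_sublist (Ln v) qn).
have k0 : (0 < k)%N by exact: ltn_trans k2.
have kl : (k.-1 < k)%N by rewrite ltn_predL.
pose A := P (Ordinal k0); pose B := P (Ordinal kl).
have AB : [disjoint A & B].
  rewrite -setI_eq0; apply/eqP/setP => v; rewrite !inE; apply/negP.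
  case/andP => vA vB; have [i [_ iu]] := Puniq v.
  have := iu _ vA; rewrite (iu _ vB) => /(congr1 val)/= kE.
  by move: k2; rewrite -ltn_predRL kE.
have [f [fp fs]] := exists_coloring_from m0 k2 Hu Hd (fun e eE => Pe e eE _)
  (fun e eE => Pe e eE _) AB (fun v => let: And3 h _ _ := sP v in h)
  (fun v => let: And3 _ h _ := sP v in h) D0 Cq fail.
by exists f; split=> // v; have [_ _] := sP v; apply.
Qed.

Theorem theorem1p6 (R : realType) (eps : R) (k : nat)
    (eps_gt0 : 0 < eps) (k_ge2 : (2 <= k)%N) :
  exists Delta0 : nat, forall Delta : nat, (Delta0 <= Delta)%N ->
  forall H : hypergraph,
    uniform k H -> partite k H -> (max_degree H <= Delta)%N ->
    (choice_number H)%:R <=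
      (4 / 5 * (k%:R - 1 + eps) * (Delta%:R / ln Delta%:R))
        `^ (1 / (k%:R - 1)) :> R.
Proof.
pose C : R := (2 * cbw 16)^-1.
have C0 : 0 < C by rewrite invr_gt0 mulr_gt0 ?cbw_gt0.
have n0 : (0 < k.-1)%N by case: k k_ge2 => [|[]].
have kE : k%:R - 1 = k.-1%:R :> R.
  by rewrite -(ltn_predK k_ge2) -natr1 addrK.
have K1 : 1 <= k%:R :> R by rewrite (ler_nat _ 1) ltnW.
have [L0 L0_gt0 asymp] := fail_prob_asymp C0 eps_gt0 n0 K1.
exists (Num.truncn (expR L0)).+1 => Delta DD0 H Hu Hp Hd.
set Q := (_ `^ _).
have D_ge : expR L0 <= Delta%:R.
  by apply: ltW; rewrite -truncn_lt_nat// expR_ge0.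
have D0 : 0 < Delta%:R :> R by exact: lt_le_trans (expR_gt0 _) D_ge.
have DE : expR (ln Delta%:R) = Delta%:R :> R by rewrite lnK.
have LD : L0 <= ln Delta%:R by rewrite -ler_expR DE.
have base_ge0 : 0 <= 4 / 5 * (k%:R - 1 + eps) * (Delta%:R / ln Delta%:R).
  rewrite mulr_ge0 ?divr_ge0//; last by lra.
  by rewrite kE mulr_ge0 ?addr_ge0//; lra.
have Q_ge0 : 0 <= Q by exact: powR_ge0.
have QE : Q ^+ k.-1 =
    4 / 5 * (k.-1%:R + eps) * (expR (ln Delta%:R) / ln Delta%:R).
  rewrite DE -kE -powR_mulrn// -powRrM kE mul1r mulVf ?powRr1//.
    by rewrite -kE.
  by rewrite pnatr_eq0 -lt0n.
(* Lists of [n] colours are trimmed to [16 * m], to be cut into 16 equal blocks; both roundings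
   together cost less than 16. *)
pose n := Num.truncn Q; pose m := (n %/ 16)%N.
have n_le : n%:R <= Q by rewrite truncn_le.
have qn : (16 * m <= n)%N by rewrite mulnC leq_divM.
have Qq : Q - 16 <= (16 * m)%:R.
  have : Q < n.+1%:R by exact: truncnS_gt.
  have : (n.+1 <= 16 * m + 16)%N.
    by rewrite {1}(divn_eq n 16) -/m mulnC -addnS leq_add2l ltn_pmod.
  by rewrite -(ler_nat R) natrD; lra.
have [q_gt0 Cq fail] := asymp _ _ _ LD Q_ge0 QE Qq.
apply: le_trans n_le; rewrite ler_nat.
(* Edges have [k >= 2] vertices, so [choice_number] is a genuine minimum and not the default 0. *)
have [_] := choice_numberP (fun e (eE : e \in edges H) =>
  eq_ind_r (fun i => (1 < i)%N) k_ge2 (Hu e eE)).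
apply; apply: (partite_choosable (R := R) (k := k) (m := m) (Delta := Delta)) => //.
- by rewrite -(ltr_nat R).
- by move: q_gt0; rewrite ltr0n muln_gt0.
- by move: fail; rewrite DE [(k * _)%:R]natrM natrX.
Qed.
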